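(* Let $\Gamma$ be a relevant collection such that $\Gamma-\{S\}$ is an hke collection for each $S\in\Gamma$. Then there exists an integer $m$ such that $$\Big|\bigcap\Gamma_1-\bigcup\Gamma_2\Big|-\Big|\bigcap\Gamma_2-\bigcup\Gamma_1\Big|=(-1)^{|\Gamma_1|+1}m$$ holds for every partition $\{\Gamma_1,\Gamma_2\}$ of $\Gamma$ into two non-empty subcollections.
   Context: A relevant collection is a finite collection $F$ of finite sets all having the same cardinality, a positive integer denoted $\alpha(F)$. A collection $F$ of sets is an hereditary Konig–Egervary (hke) collection if there is a positive integer $\alpha$ such that $|\bigcup\Gamma|+|\bigcap\Gamma|=2\alpha$ for every non-empty subcollection $\Gamma\subseteq F$. *)

(* Defs.v *)
From mathcomp Require Import all_boot all_algebra.

Set Implicit Arguments.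
Unset Strict Implicit.
Unset Printing Implicit Defensive.

(* Finite collections of finite sets are sets of subsets of a finite type T:
   any such collection lives in a finite ground set, e.g. its union. *)

Definition relevant_collection (T : finType) (F : {set {set T}}) : Prop :=
  exists2 alpha : nat, 0 < alpha & forall S : {set T}, S \in F -> #|S| = alpha.

(* Over the empty family \bigcap is setT; the condition G != set0 keeps that
   case out. *)
Definition hke_collection (T : finType) (F : {set {set T}}) : Prop :=
  exists2 alpha : nat, 0 < alpha &
    forall G : {set {set T}}, G \subset F -> G != set0 ->
      #|\bigcup_(S in G) S| + #|\bigcap_(S in G) S| = 2 * alpha.

(* The library's partition forbids empty blocks; G1 != G2 is needed because
   [set G; G] is the one-block partition of G. *)
Definition two_block_partition (T : finType) (G1 G2 G : {set {set T}}) : Prop :=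
  G1 != G2 /\ partition [set G1; G2] G.

(* Main.v *)
Require Import Defs.
From mathcomp Require Import all_boot all_algebra.
From mathcomp Require Import zify.

Set Implicit Arguments.
Unset Strict Implicit.
Unset Printing Implicit Defensive.

(** Write [f G1 G2] for the difference on the left-hand side.  Splitting both
    of its terms according to membership in a set [S] gives
    [f G1 (S |: G2) + f (S |: G1) G2 = f G1 G2].  By induction on [G2], starting
    from the hke identity for a singleton, this shows that [f] vanishes on an
    hke collection.  Since [Gamma :\ S] is hke, moving [S] from one block to
    the other only changes the sign of [f], and any two blocks are linked by
    such moves, except that the two singletons of a two-element [Gamma] are
    not; there [f] vanishes because the sets have equal cardinality. *)

Lemma setU1_neq0 (T : finType) (x : T) (A : {set T}) : x |: A != set0.
Proof. by apply/set0Pn; exists x; rewrite setU11. Qed.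

Definition core_diff (T : finType) (G1 G2 : {set {set T}}) : int :=
  (#|(\bigcap_(S in G1) S) :\: (\bigcup_(S in G2) S)|%:Z
   - #|(\bigcap_(S in G2) S) :\: (\bigcup_(S in G1) S)|%:Z)%R.

Lemma core_diffU1 (T : finType) (S : {set T}) (G1 G2 : {set {set T}}) :
  (core_diff G1 (S |: G2) + core_diff (S |: G1) G2 = core_diff G1 G2)%R.
Proof.
have cardsplit (A B : {set T}) :
    #|A :\: (S :|: B)| + #|(S :&: A) :\: B| = #|A :\: B|.
  rewrite -(cardsID S (A :\: B)) addnC; congr (_ + _); apply: eq_card => x;
    rewrite !inE; by case: (x \in S); case: (x \in A); case: (x \in B).
rewrite /core_diff !bigcup_setU !bigcap_setU !big_set1.
have := cardsplit (\bigcap_(i in G1) i) (\bigcup_(i in G2) i).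
have := cardsplit (\bigcap_(i in G2) i) (\bigcup_(i in G1) i).
lia.
Qed.

(** With [I] and [U] the intersection and union of [G], subtracting the hke identities for [G] and
    [S |: G] leaves [#|I| - #|S :&: I| = #|S :|: U| - #|U|], that is, [#|I :\: S| = #|S :\: U|]. *)
Lemma core_diff_set1 (T : finType) (G : {set {set T}}) (S : {set T}) :
  hke_collection (S |: G) -> G != set0 -> core_diff G [set S] = 0%R.
Proof.
case=> alpha _ hke G0.
have := hke G (subsetUr _ _) G0.
have := hke (S |: G) (subxx _) (setU1_neq0 S G).
rewrite /core_diff bigcup_setU bigcap_setU !big_set1.
set U := \bigcup_(i in G) i; set I := \bigcap_(i in G) i.
have := cardsID S I; rewrite setIC.
have := cardsUI S U; have := cardsID U S.
lia.
Qed.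

Lemma core_diff_hke (T : finType) (F G1 G2 : {set {set T}}) :
  hke_collection F -> G1 \subset F -> G2 \subset F ->
  G1 != set0 -> G2 != set0 -> core_diff G1 G2 = 0%R.
Proof.
move=> hkeF; have [n] := ubnP #|G2|; elim: n => // n IHn in G1 G2 *.
move=> ltG2n G1F G2F G1_0 /set0Pn[S SG2].
have SF := subsetP G2F S SG2.
rewrite -(setD1K SG2) in ltG2n G2F *.
have G2F' : G2 :\ S \subset F by apply: subset_trans G2F; apply: subsetUr.
have SG1F : S |: G1 \subset F by rewrite subUset sub1set SF.
case: (eqVneq (G2 :\ S) set0) => [->|G2_0].
  rewrite setU0; apply: core_diff_set1 => //.
  case: hkeF => alpha a0 hke; exists alpha => // G GG; apply: hke.
  exact: subset_trans SG1F.
have ltn : #|G2 :\ S| < n by move: ltG2n; rewrite cardsU1 !inE eqxx.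
(* Both remaining terms have the smaller second block [G2 :\ S]; one of them has first block
   [S |: G1], hence the induction over all [G1]. *)
have := core_diffU1 S G1 (G2 :\ S).
rewrite (IHn _ _ ltn G1F) // (IHn _ _ ltn SG1F) ?setU1_neq0 //.
by rewrite GRing.addr0.
Qed.

Section Blocks.

Variables (T : finType) (Gamma : {set {set T}}).
Hypothesis relGamma : relevant_collection Gamma.
Hypothesis hkeGamma : forall S, S \in Gamma -> hke_collection (Gamma :\ S).

(** The candidate for [m]: the sign is its own inverse, so it can be moved to the other side of the
    claimed identity. *)
Let signed_diff (A : {set {set T}}) : int :=
  ((-1) ^+ (#|A| + 1) * core_diff A (Gamma :\: A))%R.

Lemma signed_diffU1 (S : {set T}) (A : {set {set T}}) :
  S |: A \proper Gamma -> S \notin A -> A != set0 ->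
  signed_diff (S |: A) = signed_diff A.
Proof.
move=> /properP[SA_Gamma [S' S'Gamma S'SA]] SA A0.
move: SA_Gamma; rewrite subUset sub1set => /andP[SGamma AGamma].
have DE : Gamma :\: A = S |: (Gamma :\: (S |: A)).
  apply/setP=> x; rewrite !inE; case: eqVneq => [->|//].
  by rewrite SA SGamma.
(* Both blocks avoid [S], so they lie in the hke collection [Gamma :\ S]; the witness [S'] of
   properness keeps the second one non-empty. *)
have zero : core_diff A (Gamma :\: (S |: A)) = 0%R.
  apply: (core_diff_hke (hkeGamma SGamma)) => //.
  - by rewrite subsetD1 AGamma.
  - by rewrite subsetD1 subsetDl !inE eqxx.
  - by apply/set0Pn; exists S'; rewrite inE S'SA.
have := core_diffU1 S A (Gamma :\: (S |: A)); rewrite -DE zero => /eqP.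
rewrite GRing.addr_eq0 => /eqP diffN.
rewrite /signed_diff cardsU1 SA diffN add1n addSn GRing.exprS.
by rewrite GRing.mulN1r GRing.mulNr GRing.mulrN.
Qed.

(** The members of [A] other than [S] are removed one at a time; [S] stays, so the block never
    becomes empty. *)
Lemma signed_diff_mem (S : {set T}) (A : {set {set T}}) :
  A \proper Gamma -> S \in A -> signed_diff A = signed_diff [set S].
Proof.
have [n] := ubnP #|A|; elim: n => // n IHn in A *.
move=> ltAn AGamma SA.
have [AS|/set0Pn[S' /setD1P[S'S S'A]]] := eqVneq (A :\ S) set0.
  by rewrite -(setD1K SA) AS setU0.
have SA' : S \in A :\ S' by rewrite !inE eq_sym S'S.
rewrite -(setD1K S'A) signed_diffU1 ?setD1K ?setD11 //.
  apply: IHn => //; first by move: ltAn; rewrite (cardsD1 S' A) S'A.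
  by apply: sub_proper_trans AGamma; apply: subD1set.
by apply/set0Pn; exists S.
Qed.

Lemma signed_diff_set1 (S S' : {set T}) :
  S \in Gamma -> S' \in Gamma -> signed_diff [set S] = signed_diff [set S'].
Proof.
move=> SGamma S'Gamma; have [->//|SS'] := eqVneq S S'.
have sub : [set S; S'] \subset Gamma by rewrite subUset !sub1set SGamma.
have [GammaE|neq] := eqVneq [set S; S'] Gamma; last first.
  (* The pair is a proper block containing both sets, so it links the two singletons. *)
  have prop : [set S; S'] \proper Gamma by rewrite properEneq neq.
  rewrite -(signed_diff_mem prop (set21 _ _)).
  by rewrite (signed_diff_mem prop (set22 _ _)).
have [alpha _ card_alpha] := relGamma.
(* Sets of equal cardinality have differences [X :\: Y] and [Y :\: X] of equal cardinality. *)
have zero (X Y : {set T}) : X \in Gamma -> Y \in Gamma ->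
    core_diff [set X] [set Y] = 0%R.
  move=> /card_alpha cX /card_alpha cY; rewrite /core_diff !big_set1.
  by have := cardsID X Y; have := cardsID Y X; rewrite setIC; lia.
rewrite /signed_diff -GammaE.
have -> : [set S; S'] :\: [set S] = [set S'].
  by rewrite setU1K // inE.
have -> : [set S; S'] :\: [set S'] = [set S].
  by rewrite setUC setU1K // inE eq_sym.
by rewrite !zero // !GRing.mulr0.
Qed.

Lemma core_diff_const :
  exists m : int, forall A : {set {set T}}, A \proper Gamma -> A != set0 ->
    core_diff A (Gamma :\: A) = ((-1) ^+ (#|A| + 1) * m)%R.
Proof.
have [Gamma0|[S0 S0Gamma]] := set_0Vmem Gamma.
  (* The empty collection has no proper subcollection, so any integer would do. *)
  by exists 0%R => A; rewrite Gamma0 properE sub0set andbF.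
exists (signed_diff [set S0]) => A AGamma /set0Pn[S SA].
have SGamma := subsetP (proper_sub AGamma) S SA.
rewrite -(signed_diff_set1 SGamma S0Gamma) -(signed_diff_mem AGamma SA).
rewrite GRing.mulrA -GRing.exprMn GRing.mulrNN GRing.mulr1.
by rewrite GRing.expr1n GRing.mul1r.
Qed.

End Blocks.

Lemma two_block_partitionD (T : finType) (G1 G2 G : {set {set T}}) :
  two_block_partition G1 G2 G ->
  [/\ G1 != set0, G1 \proper G & G2 = G :\: G1].
Proof.
case=> neq /and3P[/eqP covG tI]; rewrite !inE negb_or => /andP[G10 G20].
have disj : [disjoint G1 & G2].
  by apply: (trivIsetP tI) => //; rewrite !inE eqxx ?orbT.
have GE : G1 :|: G2 = G by rewrite -covG /cover big_setU1 ?inE //= big_set1.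
split; first by rewrite eq_sym.
  rewrite -GE properE subsetUl subUset subxx /=.
  (* If [G1] were all of [G], then [G2], being contained in [G1] and disjoint from it, would be
     empty. *)
  apply: contra G20 => G21; rewrite eq_sym -subset0 -(disjoint_setI0 disj).
  by rewrite subsetI G21 subxx.
rewrite -GE setDUl setDv set0U; apply/esym/setDidPl.
by rewrite disjoint_sym.
Qed.

Theorem theorem2p6 (T : finType) (Gamma : {set {set T}}) :
  relevant_collection Gamma ->
  (forall S : {set T}, S \in Gamma -> hke_collection (Gamma :\ S)) ->
  exists m : int, forall Gamma1 Gamma2 : {set {set T}},
    two_block_partition Gamma1 Gamma2 Gamma ->
    (#|(\bigcap_(S in Gamma1) S) :\: (\bigcup_(S in Gamma2) S)|%:Z
     - #|(\bigcap_(S in Gamma2) S) :\: (\bigcup_(S in Gamma1) S)|%:Z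
     = (-1) ^+ (#|Gamma1| + 1) * m)%R.
Proof.
move=> rel hke; have [m mP] := core_diff_const rel hke.
exists m => G1 G2 /two_block_partitionD[G1_0 G1_Gamma ->].
exact: mP.
Qed.
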